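(* Let $\{a_n\}_{n=1}^{\infty}$ be a sequence of positive integers satisfying $$\limsup_{n\to\infty}\frac{1}{n}\log a_n=0.$$ Then there exists a minimal and uniquely ergodic subshift $(Y,\sigma)$, with $Y\subseteq\{0,1\}^{\mathbb{Z}}$, such that $$\limsup_{n\to\infty}\frac{P_Y(n)}{a_n}=\infty$$ and such that the unique $\sigma$-invariant Borel probability measure $\mu$ on $Y$ has the following property: there is a sequence of positive integers $\{n_k\}_{k=1}^{\infty}$ with $n_k\to\infty$ satisfying $$\liminf_{k\to\infty}\,\min\left\{\mu([w]_0^+)\cdot n_k\colon w\in\mathcal{L}_{n_k}(Y)\right\}>0.$$
   Context: The space $\{0,1\}^{\mathbb{Z}}$ carries the product topology, and $\sigma$ denotes the left shift, $(\sigma x)_n=x_{n+1}$. A subshift $(Y,\sigma)$ is a closed $\sigma$-invariant set $Y\subseteq\{0,1\}^{\mathbb{Z}}$ with the restriction of $\sigma$. For a word $w=(w_0,\dots,w_{n-1})\in\{0,1\}^n$, the one-sided cylinder set is $[w]_0^+=\{x\in Y\colon x_j=w_j\text{ for }0\le j\le n-1\}$. $\mathcal{L}_n(Y)$ is the set of all $w\in\{0,1\}^n$ with $[w]_0^+\neq\emptyset$, and the word complexity is $P_Y(n)=|\mathcal{L}_n(Y)|$. A subshift is uniquely ergodic if it has exactly one $\sigma$-invariant Borel probability measure. *)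

(* Defs.v *)
From HB Require Import structures.
From mathcomp Require Import all_boot all_order all_algebra.
From mathcomp Require Import all_classical all_reals all_analysis.

Set Implicit Arguments.
Unset Strict Implicit.
Unset Printing Implicit Defensive.

Import Order.TTheory GRing.Theory Num.Theory.
Import numFieldNormedType.Exports.

Local Open Scope classical_set_scope.
Local Open Scope ring_scope.

Definition full_shift : Type := prod_topology (fun _ : int => bool).

HB.instance Definition _ := Pointed.on full_shift.
HB.instance Definition _ := Topological.on full_shift.

Definition left_shift (x : full_shift) : full_shift := fun n : int => x (n + 1).

Definition subshift (Y : set full_shift) : Prop :=
  closed Y /\ left_shift @` Y = Y.

Definition minimal (Y : set full_shift) : Prop :=
  Y !=set0 /\
  forall Z : set full_shift,
    subshift Z -> Z !=set0 -> Z `<=` Y -> Z = Y.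

Definition cylinder (Y : set full_shift) n (w : n.-tuple bool) :
    set full_shift :=
  [set x | Y x /\ forall j : 'I_n, x (j : nat)%:Z = tnth w j].

Definition language (Y : set full_shift) n : {set n.-tuple bool} :=
  [set w : n.-tuple bool | `[< cylinder Y w !=set0 >]]%SET.

Definition complexity (Y : set full_shift) (n : nat) : nat := #|language Y n|.

Notation borel_full_shift := (g_sigma_algebraType (@open full_shift)).

(* A Borel probability measure on the closed set Y is identified with the
   Borel probability measure it induces on the full shift, i.e. with one that
   gives Y full mass; the Borel sets of Y are the traces on Y of those of the
   full shift. *)
Definition invariant_on (R : realType) (Y : set full_shift)
    (mu : probability borel_full_shift R) : Prop :=
  mu Y = 1%E /\
  forall A : set borel_full_shift, measurable A -> mu (left_shift @^-1` A) = mu A.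

(* Uniqueness is asked on measurable sets only: the values of a MathComp
   measure elsewhere are unconstrained. *)
Definition uniquely_ergodic (R : realType) (Y : set full_shift) : Prop :=
  exists2 mu : probability borel_full_shift R, invariant_on Y mu &
    forall nu : probability borel_full_shift R, invariant_on Y nu ->
      forall A : set borel_full_shift, measurable A -> nu A = mu A.

(* Main.v *)
From HB Require Import structures.
Require Import Defs.
From mathcomp Require Import all_boot all_order all_algebra.
From mathcomp Require Import all_classical all_reals all_analysis.
From mathcomp Require Import measurable_realfun.
From mathcomp Require Import zify ring lra.
Import Order.TTheory GRing.Theory Num.Theory.
Import numFieldNormedType.Exports.
Local Open Scope classical_set_scope.
Local Open Scope ring_scope.
Set Implicit Arguments.
Unset Strict Implicit.
Unset Printing Implicit Defensive.

(** The subshift is a generalised Morse sequence space. A block of length [L] is a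
    word [beta] together with its complement; inflating a sequence of symbols by the block
    replaces the symbol [b] by the word [b (+) beta]. A tower of blocks is built by
    alternating two kinds of inflation, and [Y] consists of the points all of whose windows
    occur, for every level [k], in a concatenation of the two words of level [k].

    The first kind of inflation uses the fixed word [00110]. It and its complement
    contain all four pairs of symbols, so every pair of level [k] words occurs in
    each word five times as long. A word of length [L_k] of the language sits
    inside a pair of level [k] words; hence it occurs in every window of length
    [10 L_k] ([tower_recurrence]). This gives minimality, and integrating the number
    of occurrences against an invariant measure gives [mu [w] >= 1 / (10 L_k)], which
    is the required lower bound with [n_k = L_k].

    The second kind uses a word that lists all words of length [m] over the two symbols and
    then the complement of that list. If [L] is the current block length, this forces
    at least [2 ^ m] words of length [m L] ([tower_complexity]). Since [a] grows
    subexponentially, [k * a (m L) <= 2 ^ m] for a suitable [m], which is chosen at step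
    [k] once [L] is known. There is no conflict between the two requirements, because
    linear recurrence is only claimed at the scales [L_k], below the scale [m L]
    where the complexity is large.

    For unique ergodicity, the list followed by its complement contains equally many symbols
    of both kinds. Up to errors at the ends of the blocks, which are a
    proportion [O(1 / L)], both words of the next level therefore contain any given
    finite pattern equally often, so that Birkhoff sums of window events are uniformly
    close to each other on [Y] ([tower_discrepancy]); two invariant measures then agree on
    these events, and they generate the Borel sets. Existence of an invariant measure
    is the Krylov-Bogoliubov argument ([invariant_probability]): limits of orbit averages
    along an ultrafilter give an invariant finitely additive mean, which
    compactness and the extension theorem turn into a measure. *)

(** * Windows and the topology of the full shift *)

Definition agree (n : nat) (x y : full_shift) : Prop :=
  forall i : int, (`|i| <= n)%N -> x i = y i.

(** Events decided by the window of radius [n]; over all [n] they are exactly the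
    clopen sets of the full shift. *)
Definition local (n : nat) (A : set full_shift) : Prop :=
  forall x y, agree n x y -> A x -> A y.

Definition finitary (A : set full_shift) : Prop := exists n, local n A.

Definition shift (p : int) (x : full_shift) : full_shift := fun n => x (n + p).

Lemma agreexx n x : agree n x x.
Proof. by []. Qed.

Lemma agree_sym n x y : agree n x y -> agree n y x.
Proof. by move=> xy i /xy ->. Qed.

Lemma agree_trans n x y z : agree n x y -> agree n y z -> agree n x z.
Proof. by move=> xy yz i ni; rewrite (xy _ ni) yz. Qed.

Lemma agree_le m n x y : (m <= n)%N -> agree n x y -> agree m x y.
Proof. by move=> mn xy i im; apply: xy; exact: leq_trans mn. Qed.

Lemma shiftD p q x : shift p (shift q x) = shift (p + q) x.
Proof. by apply/funext => n; rewrite /shift addrA. Qed.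

Lemma shift0 x : shift 0 x = x.
Proof. by apply/funext => n; rewrite /shift addr0. Qed.

Lemma agree_shift n p x y : agree (n + `|p|) x y ->
  agree n (shift p x) (shift p y).
Proof. by move=> xy i ni; apply: xy; lia. Qed.

Lemma local_le m n A : (m <= n)%N -> local m A -> local n A.
Proof. by move=> mn lA x y xy; apply: lA; exact: agree_le xy. Qed.

Lemma localC n A : local n A -> local n (~` A).
Proof. by move=> lA x y /agree_sym xy nAx /(lA _ _ xy). Qed.

Lemma localI n A B : local n A -> local n B -> local n (A `&` B).
Proof. by move=> lA lB x y xy [/(lA _ _ xy) ? /(lB _ _ xy)]. Qed.

Lemma local_shift n p A : local n A -> local (n + `|p|) (shift p @^-1` A).
Proof. by move=> lA x y /agree_shift; exact: lA. Qed.

Lemma finitary0 : finitary set0.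
Proof. by exists 0%N. Qed.

Lemma finitaryC A : finitary A -> finitary (~` A).
Proof. by move=> [n lA]; exists n; exact: localC. Qed.

Lemma finitaryI A B : finitary A -> finitary B -> finitary (A `&` B).
Proof.
move=> [m lA] [n lB]; exists (maxn m n).
by apply: localI; [apply: local_le lA|apply: local_le lB]; lia.
Qed.

Lemma finitaryU A B : finitary A -> finitary B -> finitary (A `|` B).
Proof.
move=> fA fB; rewrite -[A `|` B]setCK setCU.
by apply/finitaryC/finitaryI; exact: finitaryC.
Qed.

Lemma finitary_shift p A : finitary A -> finitary (shift p @^-1` A).
Proof. by move=> [n lA]; exists (n + `|p|)%N; exact: local_shift. Qed.

Lemma agree_nbhs n (x : full_shift) : nbhs x (agree n x).
Proof.
have coord (i : int) : \forall y \near x, x i = y i.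
  have cx := @proj_continuous int (fun=> bool) i x.
  have : nbhs (proj i x : bool) [set b | x i = b].
    by rewrite nbhs_principalE; apply/principal_filterP.
  by move=> /cx.
have H : \forall y \near x, forall k : 'I_(n.*2.+1),
  x ((k : nat)%:Z - n%:Z) = y ((k : nat)%:Z - n%:Z).
  apply: (filter_forall (F := nbhs x)
    (f := fun (k : 'I_(n.*2.+1)) (y : full_shift) =>
      x ((k : nat)%:Z - n%:Z) = y ((k : nat)%:Z - n%:Z))) => k.
  exact: coord.
near=> y => i ni.
have kb : (absz (i + n%:Z)%R < n.*2.+1)%N by lia.
have yk : forall k : 'I_(n.*2.+1), x ((k : nat)%:Z - n%:Z) = y ((k : nat)%:Z - n%:Z).
  by near: y; exact: H.
have := yk (Ordinal kb); rewrite /=.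
by have -> : (absz (i + n%:Z))%:Z - n%:Z = i by lia.
Unshelve. all: by end_near. Qed.

Lemma local_open n A : local n A -> open A.
Proof.
move=> lA; rewrite openE => x Ax; apply: filterS (agree_nbhs n x) => y xy.
exact: lA xy Ax.
Qed.

Lemma local_closed n A : local n A -> closed A.
Proof. by move=> /localC/local_open/open_closedC; rewrite setCK. Qed.

Lemma nbhs_agree (x : full_shift) (A : set full_shift) :
  nbhs x A -> exists n, agree n x `<=` A.
Proof.
move=> xA; apply: contrapT => nA.
have /choice[y yA] n : exists y, agree n x y /\ ~ A y.
  apply: contrapT => ny; apply: nA; exists n => y xy. 
  by apply: contrapT => nAy; apply: ny; exists y.
have yx : y n @[n --> \oo] --> x.
  apply/cvg_sup => i; apply/cvg_image.
    by apply/seteqP; split => // b _; exists (fun=> b).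
  move=> B; rewrite nbhs_principalE => /principal_filterP Bx.
  exists ((fun z : int -> bool => z i) @^-1` B); last first.
    by apply/seteqP; split => [_ [z Bz <-] //|b Bb]; exists (fun=> b).
  by exists `|i|%N => // n /= ni; rewrite -((yA n).1 i ni).
have [N _ /(_ N (leqnn N))] := yx _ xA.
exact: (yA N).2.
Qed.

Lemma closed_agree (Z : set full_shift) x : closed Z ->
  (forall N, exists2 z, Z z & agree N x z) -> Z x.
Proof.
move=> cZ Zx; apply: cZ => B /nbhs_agree[N xB].
by have [z Zz xz] := Zx N; exists z; split=> //; exact: xB.
Qed.

Lemma full_shift_compact : compact [set: full_shift].
Proof.
have := @tychonoff int (fun=> bool) (fun=> setT) (fun=> bool_compact).
by congr (compact _); apply/seteqP.
Qed.

(** The [n]-th set collects the points whose window of radius [n] already forces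
    membership in [U]; it is finitary even when [U] is not. *)
Lemma open_bigcup_finitary (U : set full_shift) : open U ->
  exists F : (set full_shift)^nat, (forall n, finitary (F n)) /\
    U = \bigcup_n F n.
Proof.
rewrite openE => oU; exists (fun n => [set x | agree n x `<=` U]); split.
  move=> n; exists n => x y xy xU z yz; apply: xU; exact: agree_trans yz.
apply/seteqP; split=> [x /oU /nbhs_agree[n xU]|x [n _]]; first by exists n.
by apply; exact: agreexx.
Qed.

(** This is how compactness yields a point of a subshift from points that satisfy
    longer and longer finite constraints. *)
Lemma cluster_point (z : nat -> full_shift) :
  exists x, forall n N, exists2 j, (n <= j)%N & agree N x (z j).
Proof.
have [|x [_ xz]] := full_shift_compact (F := z @ \oo) _.
  exact: filterT.
exists x => n N.
have zn : (z @ \oo) [set z j | j in [set j | n <= j]%N].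
  by exists n => // j /= nj; exists j.
have [_ [[j /= nj <-] xj]] := xz _ _ zn (agree_nbhs N x).
by exists j.
Qed.

(** A finitary set is compact and finitary sets are open, so a finite subcover
    exists; disjointness leaves nothing for the other members. This is why a finitely additive
    function on the finitary sets is automatically countably additive. *)
Lemma finitary_bigcup_finite (F : (set full_shift)^nat) :
  (forall n, finitary (F n)) -> trivIset setT F -> finitary (\bigcup_n F n) ->
  exists m, forall n, (m <= n)%N -> F n = set0.
Proof.
move=> fF tF [N lU].
have : compact (\bigcup_n F n).
  apply: (subclosed_compact _ full_shift_compact) => //; exact: local_closed lU.
rewrite compact_cover => /(_ nat setT F) [].
- by move=> n _; have [k /local_open] := fF n.
- by [].
move=> D _ UD; exists (\max_(i <- finmap.enum_fset D) i).+1 => n Dn.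
apply/seteqP; split=> // x Fx.
have [m /= Dm Fm] := UD x (ex_intro2 _ _ n I Fx).
have mn : m = n by apply: tF => //; exists x.
have : (m <= \max_(i <- finmap.enum_fset D) i)%N by exact: leq_bigmax_seq.
by rewrite mn leqNgt Dn.
Qed.

(** * Birkhoff sums and invariant measures *)

Lemma left_shiftE : left_shift = shift 1.
Proof. by []. Qed.

Lemma shift_in (Y : set full_shift) (n : nat) x :
  left_shift @` Y = Y -> Y x -> Y (shift n%:Z x).
Proof.
move=> sY; elim: n => [|n IH] Yx; first by rewrite shift0.
by rewrite intS -shiftD -left_shiftE -[X in X _]sY; exists (shift n%:Z x) => //; exact: IH.
Qed.

Lemma open_shift p (U : set full_shift) : open U -> open (shift p @^-1` U).
Proof.
move=> /open_bigcup_finitary[F [fF ->]]; rewrite preimage_bigcup.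
apply: bigcup_open => n _.
by have [k lk] := finitary_shift p (fF n); exact: local_open lk.
Qed.

Lemma finitary_measurable (A : set borel_full_shift) :
  finitary A -> measurable A.
Proof. by move=> [n lA]; apply: sub_sigma_algebra; exact: local_open lA. Qed.

Lemma borelE : (@measurable _ borel_full_shift) = <<s finitary >>.
Proof.
apply/seteqP; split; apply: smallest_sub; try exact: smallest_sigma_algebra.
  move=> U /open_bigcup_finitary[F [fF ->]].
  by apply: sigma_algebra_bigcup => n; exact: sub_sigma_algebra.
by move=> A; exact: finitary_measurable.
Qed.

Lemma shift_measurable p :
  measurable_fun setT (shift p : borel_full_shift -> borel_full_shift).
Proof.
refine (@measurability _ _ borel_full_shift borel_full_shift setT (shift p)
  (@open full_shift) erefl _).
move=> _ [U oU <-]; rewrite setTI.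
by apply: sub_sigma_algebra; exact: open_shift.
Qed.

Section birkhoff.
Variable R : realType.

Definition birkhoff N (A : set full_shift) (x : full_shift) : R :=
  \sum_(i < N) \1_A (shift i%:Z x).

Lemma birkhoffC N A x : birkhoff N (~` A) x = N%:R - birkhoff N A x.
Proof.
transitivity (\sum_(i < N) (1 - \1_A (shift i%:Z x) : R)).
  apply: eq_bigr => i _; rewrite !indicE in_setC.
  by case: (_ \in _); rewrite /= ?subrr ?subr0.
by rewrite sumrB sumr_const card_ord.
Qed.

Lemma birkhoff_ge0 N A y : 0 <= birkhoff N A y.
Proof. by rewrite sumr_ge0. Qed.

Lemma birkhoff_preimage N A p x :
  birkhoff N (shift p @^-1` A) x = birkhoff N A (shift p x).
Proof.
apply: eq_bigr => i _; rewrite !indicE; congr (_%:R); congr nat_of_bool.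
by apply/idP/idP; rewrite !inE /= !shiftD addrC.
Qed.

(** Telescoping: only the two end terms change. *)
Lemma birkhoff_shift1 N A x :
  birkhoff N A (shift 1 x) = birkhoff N A x + (\1_A (shift N%:Z x) - \1_A x).
Proof.
case: N => [|N]; first by rewrite /birkhoff !big_ord0 shift0 subrr addr0.
rewrite /birkhoff [in LHS]big_ord_recr [in RHS]big_ord_recl /= shift0.
rewrite shiftD [(N%:Z + 1)%R]addrC -intS.
under eq_bigr => i _ do rewrite shiftD addrC -intS.
by ring.
Qed.

Lemma norm_indicB A (x y : full_shift) : `|\1_A x - \1_A y| <= 1 :> R.
Proof.
rewrite !indicE; case: (_ \in _); case: (_ \in _);
by rewrite ?subrr ?subr0 ?sub0r ?normrN ?normr1 ?normr0.
Qed.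

Variables (Y : set full_shift) (mu : probability borel_full_shift R).
Hypothesis inv : invariant_on Y mu.

Lemma invariant_shift (i : nat) (A : set borel_full_shift) :
  measurable A -> mu (shift i%:Z @^-1` A) = mu A.
Proof.
move=> mA; elim: i => [|i IH].
  by rewrite (_ : _ @^-1` A = A)//; apply/funext => x /=; rewrite shift0.
rewrite -IH -[in RHS](inv.2 (shift i%:Z @^-1` A)).
  congr (mu _); apply/funext => x /=.
  by rewrite left_shiftE shiftD intS addrC.
by rewrite -[_ @^-1` _]setTI; exact: shift_measurable.
Qed.

(** The integral of the Birkhoff sum is [N * mu A], since every shift of [A] has
    the same mass, and only its values on [Y] matter. A uniform recurrence property
    thus becomes a lower bound on measures; an upper bound follows by passing
    to the complement of [A]. *)
Lemma le_birkhoff_measure N (A : set borel_full_shift) (c : R) :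
  measurable (Y : set borel_full_shift) -> measurable A ->
  (forall x, Y x -> c <= birkhoff N A x) -> (c%:E <= N%:R%:E * mu A)%E.
Proof.
move=> mY mA cA.
have [c0|c0] := leP 0 c; last first.
  apply: (@le_trans _ _ 0%E); first by rewrite lee_fin ltW.
  by apply: mule_ge0.
have mAi (i : nat) : measurable (shift i%:Z @^-1` A : set borel_full_shift).
  by rewrite -[_ @^-1` _]setTI; exact: shift_measurable.
have mS : measurable_fun [set: borel_full_shift]
    (EFin \o birkhoff N A : borel_full_shift -> \bar R).
  apply/measurable_EFinP/measurable_sum => i.
  exact: (measurable_indic (mAi i)).
have -> : (N%:R%:E * mu A = \int[mu]_(x in setT) (birkhoff N A x)%:E)%E.
  under eq_integral => x _ do rewrite /birkhoff -sumEFin.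
  rewrite ge0_integral_sum//; last first.
    move=> i; apply/measurable_EFinP.
    exact: (measurable_indic (mAi i)).
  transitivity (\sum_(i < N) mu A)%E.
    by rewrite sumr_const card_ord mule_natl.
  apply: eq_bigr => i _; rewrite -(invariant_shift i mA).
  by rewrite -[X in mu X]setIT -integral_indic.
rewrite -[leLHS]mule1 -inv.1 -integral_cst//.
apply: (@le_trans _ _ (\int[mu]_(x in Y) (birkhoff N A x)%:E)%E).
  by apply: ge0_le_integral => //; exact: measurable_funTS.
apply: ge0_subset_integral => //.
by move=> x _; rewrite lee_fin sumr_ge0.
Qed.

End birkhoff.

Lemma closed_measurable (Y : set borel_full_shift) :
  closed (Y : set full_shift) -> measurable Y.
Proof.
move=> cY; rewrite -[Y]setCK; apply: measurableC.
by apply: sub_sigma_algebra; exact: closed_openC.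
Qed.

Section unique.
Variables (R : realType) (Y : set full_shift).
Hypotheses (cY : closed Y) (Y0 : Y !=set0).
Hypothesis discrepancy : forall A, finitary A -> forall e : R, 0 < e ->
  exists2 N, (0 < N)%N & forall x y, Y x -> Y y ->
    birkhoff R N A x <= birkhoff R N A y + e * N%:R.

(** The Birkhoff sum at one point bounds [mu A] from below and, through the complement of
    [A], bounds [nu A] from above, both up to [e / 2]. *)
Lemma invariant_finitary_le (mu nu : probability borel_full_shift R)
    (A : set borel_full_shift) :
  invariant_on Y mu -> invariant_on Y nu -> finitary A -> (nu A <= mu A)%E.
Proof.
move=> imu inu fA; have mA := finitary_measurable fA.
have mY := closed_measurable cY; have [x0 Yx0] := Y0.
have finA (m : probability borel_full_shift R) : m A \is a fin_num.
  exact: fin_num_measure.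
rewrite -(fineK (finA mu)) -(fineK (finA nu)) lee_fin.
apply/ler_addgt0Pr => e e0.
have e2 : 0 < e / 2 by rewrite divr_gt0.
have [N N0 disc] := discrepancy fA e2.
have N0r : 0 < N%:R :> R by rewrite ltr0n.
have muA : birkhoff R N A x0 - e / 2 * N%:R <= N%:R * fine (mu A).
  rewrite -lee_fin EFinM fineK//; apply: (le_birkhoff_measure imu) => // x Yx.
  by rewrite lerBlDr; exact: disc.
have nuA : N%:R - (birkhoff R N A x0 + e / 2 * N%:R) <= N%:R * (1 - fine (nu A)).
  rewrite -lee_fin EFinM [(1 - fine _)%:E]EFinB fineK// -probability_setC//.
  apply: (le_birkhoff_measure inu) => //; first exact: measurableC.
  by move=> x Yx; rewrite birkhoffC lerD2l lerN2; exact: disc.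
rewrite -(ler_pM2l N0r); move: muA nuA; lra.
Qed.

(** The finitary sets form a pi-system that generates the Borel sets. *)
Lemma discrepancy_uniquely_ergodic (mu : probability borel_full_shift R) :
  invariant_on Y mu -> uniquely_ergodic R Y.
Proof.
move=> imu; exists mu => // nu inu A mA.
apply: (@measure_unique _ R borel_full_shift finitary (fun=> setT)) => //.
- exact: borelE.
- by move=> B C; exact: finitaryI.
- by move=> _; rewrite -setC0; apply: finitaryC; exact: finitary0.
- by rewrite bigcup_const.
- by move=> B fB; apply/eqP; rewrite eq_le !invariant_finitary_le.
- by move=> _ /=; rewrite probability_setT ltry.
Qed.

End unique.

(** * Existence of invariant measures *)

(** A copy of the full shift whose measurable sets are only the finitary ones: the
    algebra from which Caratheodory's theorem extends. *)
Definition finitary_space : Type := full_shift.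

Definition finitary_display : measure_display.
Proof. exact: default_measure_display. Qed.

HB.instance Definition _ := Pointed.on finitary_space.
HB.instance Definition _ := @isAlgebraOfSets.Build finitary_display
  finitary_space finitary finitary0 finitaryU finitaryC.

Section extension.
Variables (R : realType) (m : set full_shift -> R).
Hypotheses (m0 : forall A, 0 <= m A) (mT : m setT = 1).
Hypothesis mU : forall A B, A `&` B = set0 -> m (A `|` B) = m A + m B.

Definition premeasure (A : set finitary_space) : \bar R := (m A)%:E.

Lemma additive_set0 : m set0 = 0.
Proof.
by have /eqP := mU (setI0 set0); rewrite setU0 addrC -subr_eq subrr eq_sym => /eqP.
Qed.

Lemma additive_bigcup (F : (set full_shift)^nat) n : trivIset setT F ->
  m (\bigcup_(i < n) F i) = \sum_(i < n) m (F i).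
Proof.
move=> tF; elim: n => [|n IH]; first by rewrite bigcup_mkord !big_ord0 additive_set0.
rewrite big_ord_recr /= -IH bigcup_mkord big_ord_recr /= -bigcup_mkord mU//.
apply/seteqP; split => // x [[i /= ni Fi] Fn].
have /esym := tF n i I I (ex_intro _ x (conj Fn Fi)).
by move: ni => /[swap] ->; rewrite ltnn.
Qed.

Lemma premeasure0 : premeasure set0 = 0%E.
Proof. by rewrite /premeasure additive_set0. Qed.

Lemma premeasure_ge0 A : (0 <= premeasure A)%E.
Proof. by rewrite lee_fin. Qed.

Lemma premeasure_semi_sigma_additive : semi_sigma_additive premeasure.
Proof.
move=> F fF tF fUF; have [M FM] := finitary_bigcup_finite fF tF fUF.
have -> : \bigcup_n F n = \bigcup_(i < M) F i.
  apply/seteqP; split => [x [i _ Fi]|x [i _ Fi]]; exists i => //=.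
  by rewrite ltnNge; apply/negP => /FM Fi0; move: Fi; rewrite Fi0.
apply: cvg_near_cst; exists M => // n /= Mn.
rewrite /premeasure additive_bigcup// (big_cat_nat _ Mn)//= big_mkord.
rewrite [X in (_ + X)%E]big_nat_cond [X in (_ + X)%E]big1 ?adde0 ?sumEFin//.
by move=> i /andP[/andP[Mi _] _]; rewrite FM// additive_set0.
Qed.

HB.instance Definition _ := isMeasure.Build _ _ _ premeasure
  premeasure0 premeasure_ge0 premeasure_semi_sigma_additive.

Definition extension : set borel_full_shift -> \bar R :=
  measure_extension premeasure.

Lemma extension0 : extension set0 = 0%E.
Proof. exact: measure0. Qed.

Lemma extension_ge0 A : (0 <= extension A)%E.
Proof. exact: measure_ge0. Qed.

Lemma extension_semi_sigma_additive : semi_sigma_additive extension.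
Proof.
move=> F; rewrite borelE => mF tF mUF.
exact: (@measure_semi_sigma_additive _ _ _ (measure_extension premeasure)).
Qed.

HB.instance Definition _ := isMeasure.Build _ _ _ extension
  extension0 extension_ge0 extension_semi_sigma_additive.

Lemma extensionE (A : set full_shift) : finitary A -> extension A = (m A)%:E.
Proof. by move=> fA; rewrite /extension /measure_extension measurable_mu_extE. Qed.

Lemma extension_setT : extension setT = 1%E.
Proof.
rewrite extensionE ?mT// -setC0; apply: finitaryC; exact: finitary0.
Qed.

HB.instance Definition _ :=
  Measure_isProbability.Build _ _ _ extension extension_setT.

(** Kolmogorov's extension theorem for the full shift, in the form needed for a mean: countable
    additivity on the finitary sets comes from [finitary_bigcup_finite]. *)
Lemma finitely_additive_extension :
  exists mu : probability borel_full_shift R,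
    forall A : set full_shift, finitary A -> mu A = (m A)%:E.
Proof. by exists extension => A; exact: extensionE. Qed.

End extension.

Section krylov_bogoliubov.
Variables (R : realType) (U : set_system nat).
Hypotheses (UU : UltraFilter U) (ooU : \oo `<=` U).

(** The sequence clusters somewhere in [[0, 1]] and an ultrafilter decides each
    neighbourhood of that point. *)
Lemma ultra_cvg_bounded (u : nat -> R) :
  (forall n, 0 <= u n <= 1) -> cvg (u n @[n --> U]).
Proof.
move=> u01; have [|p [_ pu]] := @segment_compact R 0 1 (u n @[n --> U]) _.
  by apply: (@filterE _ U) => n; have := u01 n; rewrite /= in_itv.
apply/cvg_ex; exists p => V Vp.
have [//|UnV] := in_ultra_setVsetC (u @^-1` V) UU.
by have [y [nVy /nVy]] := pu (~` V) _ UnV Vp.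
Qed.

Variable x : full_shift.

Definition average (A : set full_shift) (n : nat) : R :=
  n.+1%:R^-1 * birkhoff R n.+1 A x.

(** The frequency of visits of the forward orbit of [x] to [A]; the ultrafilter makes
    the limit exist for every set. *)
Definition mean (A : set full_shift) : R := lim (average A n @[n --> U]).

Lemma average_ge0 A n : 0 <= average A n.
Proof. by rewrite mulr_ge0// birkhoff_ge0. Qed.

Lemma average_le1 A n : average A n <= 1.
Proof.
rewrite /average mulrC ler_pdivrMr// mul1r.
by have := @birkhoff_ge0 R n.+1 (~` A) x; rewrite birkhoffC subr_ge0.
Qed.

Lemma average_cvg A : average A n @[n --> U] --> mean A.
Proof.
by apply: ultra_cvg_bounded => n; rewrite average_ge0 average_le1.
Qed.

Lemma mean_eq A l : average A n @[n --> U] --> l -> mean A = l.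
Proof. exact: cvg_lim. Qed.

Lemma mean_ge0 A : 0 <= mean A.
Proof.
apply: limr_ge; first exact: average_cvg.
by apply: nearW => n; exact: average_ge0.
Qed.

Lemma mean_const A c : (forall n, average A n = c) -> mean A = c.
Proof.
move=> Ac; apply: mean_eq; rewrite (_ : average A = fun=> c); first exact: cvg_cst.
exact/funext.
Qed.

Lemma meanT : mean setT = 1.
Proof.
apply: mean_const => n; rewrite /average /birkhoff.
under eq_bigr do rewrite indicT.
by rewrite sumr_const card_ord mulVf.
Qed.

Lemma meanU A B : A `&` B = set0 -> mean (A `|` B) = mean A + mean B.
Proof.
move=> AB; apply: mean_eq.
rewrite (_ : average (A `|` B) = average A \+ average B).
  by apply: cvgD; exact: average_cvg.
apply/funext => n /=; rewrite /average -mulrDr -big_split/=; congr (_ * _).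
apply: eq_bigr => i _; rewrite !indicE in_setU.
have [yA|_] := boolP (_ \in A); have [yB|_] := boolP (_ \in B); rewrite ?addr0 ?add0r//.
by move: AB => /seteqP[/(_ (shift i%:Z x))]; case; split; exact/set_mem.
Qed.

(** The averages of [A] and of its preimage differ by at most [1 / (n + 1)]. *)
Lemma mean_shift A : mean (left_shift @^-1` A) = mean A.
Proof.
apply: mean_eq.
pose d n : R := n.+1%:R^-1 * (\1_A (shift n.+1%:Z x) - \1_A x).
have -> : average (left_shift @^-1` A) = average A \+ d.
  apply/funext => n /=; rewrite /average /d -mulrDr; congr (_ * _).
  by rewrite left_shiftE birkhoff_preimage birkhoff_shift1.
rewrite -[mean A]addr0; apply: cvgD; first exact: average_cvg.
have d0 : d n @[n --> \oo] --> 0.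
  have d1 n : `|d n| <= n.+1%:R^-1.
    by rewrite normrM ger0_norm// ler_piMr// norm_indicB.
  apply/cvgr0Pnorm_lt => e e0; near=> n; apply: le_lt_trans (d1 n) _.
  near: n; have := @cvg_harmonic R => /cvgr0Pnorm_lt /(_ e e0).
  by apply: filterS => n /=; rewrite ger0_norm//.
by move=> V /d0; exact: ooU.
Unshelve. all: by end_near. Qed.

Lemma mean_eq0 A : (forall n : nat, ~ A (shift n%:Z x)) -> mean A = 0.
Proof.
move=> Ax; apply: mean_const => n; rewrite /average /birkhoff big1 ?mulr0//.
by move=> i _; rewrite indicE memNset.
Qed.

End krylov_bogoliubov.

(** The Krylov-Bogoliubov theorem. The measure extends the mean along the orbit of a
    point of [Y]. The complement of [Y] is a countable union of finitary sets that the
    orbit never visits, so it is null; invariance passes from the finitary sets to the Borel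
    sets because two probabilities that agree on the former are equal. *)
Lemma invariant_probability (R : realType) (Y : set full_shift) :
  subshift Y -> Y !=set0 ->
  exists mu : probability borel_full_shift R, invariant_on Y mu.
Proof.
move=> [cY sY] [x Yx].
have [U [UU ooU]] := ultraFilterLemma (eventually_filter).
have [mu muE] := finitely_additive_extension
  (@mean_ge0 R U UU x) (@meanT R U UU x) (@meanU R U UU x).
have mY := closed_measurable cY.
exists mu; split.
  have -> : mu Y = (1 - mu (~` Y))%E.
    by rewrite -probability_setC ?setCK//; exact: measurableC.
  have [F [fF YF]] := open_bigcup_finitary (closed_openC cY).
  suff -> : mu (~` Y) = 0%E by rewrite sube0.
  apply/eqP; rewrite -measure_le0 YF.
  apply: le_trans (generalized_Boole_inequality _ _ _) _ => //.
  - by move=> n; exact: finitary_measurable.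
  - by apply: bigcup_measurable => n _; exact: finitary_measurable.
  rewrite eseries0// => n _ _ /=; rewrite muE// mean_eq0// => k Fn.
  have : (~` Y) (shift k%:Z x) by rewrite YF; exists n.
  by apply; exact: shift_in.
move=> A mA.
have mS : measurable_fun setT (left_shift : borel_full_shift -> borel_full_shift).
  by rewrite left_shiftE; exact: shift_measurable.
pose f : {mfun borel_full_shift >-> borel_full_shift} :=
  HB.pack (left_shift : borel_full_shift -> borel_full_shift)
    (isMeasurableFun.Build _ _ borel_full_shift borel_full_shift left_shift mS).
apply: (@measure_unique _ R borel_full_shift finitary (fun=> setT)
  _ _ _ _ (distribution mu f) mu) => //.
- exact: borelE.
- by move=> B C; exact: finitaryI.
- by move=> _; rewrite -setC0; apply: finitaryC; exact: finitary0.
- by rewrite bigcup_const.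
- move=> B fB /=; rewrite /distribution /pushforward muE ?muE ?mean_shift//.
  exact: finitary_shift.
- by move=> _ /=; rewrite probability_setT ltry.
Qed.

(** * Inflation by Morse blocks *)

(** A length [L] and a sequence of which only the first [L] letters matter. It encodes
    a word and its complement at once: the symbol [b] inflates to the word [b (+) beta]. *)
Definition block : Type := (nat * (nat -> bool))%type.

Definition inflate (P : block) (y : full_shift) : full_shift :=
  fun n => y (n %/ P.1%:Z)%Z (+) P.2 `|(n %% P.1%:Z)%Z|%N.

Definition comp (P t : block) : block :=
  ((t.1 * P.1)%N, fun i => t.2 (i %/ P.1)%N (+) P.2 (i %% P.1)%N).

(** The bi-infinite concatenations of the two words of [P], with any origin. *)
Definition tiled (P : block) (z : full_shift) : Prop :=
  exists y p, z = shift p (inflate P y).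

Lemma divz_decomposition (L : nat) (n : int) : (0 < L)%N ->
  exists (q : int) (s : nat), (s < L)%N /\ n = q * L%:Z + s%:Z.
Proof.
move=> L0; exists (n %/ L%:Z)%Z, `|(n %% L%:Z)%Z|%N.
have L0' : L%:Z != 0 by lia.
have s0 := modz_ge0 n L0'; have sL := ltz_pmod n (d := L%:Z) L0.
by split; [lia|rewrite {1}(divz_eq n L%:Z); lia].
Qed.

Lemma inflateE P y (q : int) (s : nat) : (s < P.1)%N ->
  inflate P y (q * P.1%:Z + s%:Z) = y q (+) P.2 s.
Proof.
move=> sL; rewrite /inflate divzMDl; last by lia.
by rewrite modzMDl divz_small ?modz_small ?addr0 //=; lia.
Qed.

Lemma inflate_shift P y q : (0 < P.1)%N ->
  inflate P (shift q y) = shift (q * P.1%:Z) (inflate P y).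
Proof.
move=> P0; apply/funext => n; have [a [s [sL ->]]] := divz_decomposition n P0.
by rewrite inflateE// {2}/shift addrAC -mulrDl inflateE.
Qed.

(** Inflating by a composite block is inflating twice, which makes the levels nested. *)
Lemma inflate_comp P t y : (0 < P.1)%N -> (0 < t.1)%N ->
  inflate (comp P t) y = inflate P (inflate t y).
Proof.
move=> P0 t0; apply/funext => n.
have [q [s [sL ->]]] := divz_decomposition n P0.
have [a [b [bl ->]]] := divz_decomposition q t0.
rewrite inflateE// inflateE//.
have -> : (a * t.1%:Z + b%:Z) * P.1%:Z + s%:Z =
    a * (comp P t).1%:Z + (b * P.1 + s)%N%:Z by rewrite /=; lia.
rewrite inflateE /=; last by nia.
by rewrite divnMDl// divn_small// addn0 modnMDl modn_small// addbA.
Qed.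

Lemma tiled_shift P p z : tiled P z -> tiled P (shift p z).
Proof. by move=> [y [q ->]]; exists y, (p + q); rewrite shiftD. Qed.

Lemma tiled_normal P z : (0 < P.1)%N -> tiled P z ->
  exists y (p : nat), (p < P.1)%N /\ z = shift p%:Z (inflate P y).
Proof.
move=> P0 [y [p ->]]; have [q [s [sL ->]]] := divz_decomposition p P0.
by exists (shift q y), s; rewrite inflate_shift// shiftD addrC.
Qed.

Lemma tiled_comp P t z : (0 < P.1)%N -> (0 < t.1)%N -> tiled (comp P t) z ->
  exists y (p : nat), [/\ (p < P.1)%N, tiled t y & z = shift p%:Z (inflate P y)].
Proof.
move=> P0 t0 [y [p ->]]; have [q [s [sL ->]]] := divz_decomposition p P0.
exists (shift q (inflate t y)), s; split=> //; first by exists y, q.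
by rewrite inflate_shift// shiftD addrC inflate_comp.
Qed.

Lemma tiled_comp_tiled P t z : (0 < P.1)%N -> (0 < t.1)%N ->
  tiled (comp P t) z -> tiled P z.
Proof.
by move=> P0 t0 /tiled_comp[]// y [p [_ _ ->]]; exists y, p%:Z.
Qed.

(** A window no longer than a block straddles at most two of them, so it is
    determined by two consecutive symbols. *)
Lemma inflate_pair P y y' (t : nat) : (t < 2 * P.1)%N ->
  y 0 = y' 0 -> y 1 = y' 1 -> inflate P y t%:Z = inflate P y' t%:Z.
Proof.
move=> tL y0 y1; have P0 : (0 < P.1)%N by lia.
have [tP|Pt] := ltnP t P.1.
  by rewrite -[t%:Z]add0r -(mul0r P.1%:Z) !inflateE// y0.
have -> : t%:Z = 1 * P.1%:Z + (t - P.1)%N%:Z by lia.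
by rewrite !inflateE ?y1//; lia.
Qed.

Definition pair_block : block :=
  (5%N, nth false [:: false; false; true; true; false]).

Lemma pair_block_pairs (b c d : bool) :
  exists2 e, (e < 4)%N & b (+) pair_block.2 e = c /\ b (+) pair_block.2 e.+1 = d.
Proof.
by case: b c d => [] [] [];
  first [by exists 0%N|by exists 1%N|by exists 2%N|by exists 3%N].
Qed.

(** The first block that begins to the right of the origin does so at a position in [[1, 5]], and
    contains the wanted pair at an offset at most [3]. *)
Lemma tiled_pair_block y (c d : bool) : tiled pair_block y ->
  exists q : nat, [/\ (0 < q < 9)%N, y q%:Z = c & y q.+1%:Z = d].
Proof.
move=> /tiled_normal[]// u [p [p5 ->]].
have [e e4 [ec ed]] := pair_block_pairs (u 1) c d.
exists (5 - p + e)%N; split.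
- by move: p5 => /=; lia.
- rewrite /shift -ec -inflateE /=; last by lia.
  by congr (inflate _ _ _); move: p5 => /=; lia.
- rewrite /shift -ed -inflateE /=; last by lia.
  by congr (inflate _ _ _); move: p5 => /=; lia.
Qed.

(** Letter [i] of the concatenation of all the words of length [m]. *)
Definition all_words (m : nat) (i : nat) : bool :=
  nth false (nth [::] [seq val v | v <- enum {: m.-tuple bool}] (i %/ m)) (i %% m).

Definition half_length (m : nat) : nat := (m * 2 ^ m)%N.

(** The list of all words followed by its complement: both symbols then inflate to a
    word with as many letters of one kind as of the other, and that shows the list itself. *)
Definition universal_block (m : nat) : block :=
  ((2 * half_length m)%N, fun i =>
    if (i < half_length m)%N then all_words m i
    else ~~ all_words m (i - half_length m)).

Lemma half_length_gt0 m : (0 < m)%N -> (0 < half_length m)%N.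
Proof. by move=> m0; rewrite muln_gt0 m0 expn_gt0. Qed.

Lemma universal_block_balanced m i : (i < half_length m)%N ->
  (universal_block m).2 (half_length m + i) = ~~ (universal_block m).2 i.
Proof. by move=> ih; rewrite /= ih ltnNge leq_addr addKn. Qed.

Lemma all_words_tuple m (v : m.-tuple bool) :
  exists2 r, (r + m <= half_length m)%N &
    forall j : 'I_m, all_words m (r + j) = tnth v j.
Proof.
pose k := index v (enum {: m.-tuple bool}).
have kN : (k < 2 ^ m)%N.
  have -> : (2 ^ m = size (enum {: m.-tuple bool}))%N.
    by rewrite -cardE card_tuple card_bool.
  by rewrite index_mem mem_enum.
exists (k * m)%N; first by rewrite /half_length; nia.
move=> j; rewrite /all_words divnMDl; last exact: leq_ltn_trans (ltn_ord j).
rewrite divn_small// addn0 modnMDl modn_small// (nth_map v); last first.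
  by rewrite -cardE card_tuple card_bool.
by rewrite nth_index ?mem_enum// (tnth_nth false).
Qed.

Lemma tiled_universal_block m y (v : m.-tuple bool) : (0 < m)%N ->
  tiled (universal_block m) y ->
  exists2 q : nat, (0 < q <= 4 * half_length m - m)%N &
    forall j : 'I_m, y (q + j)%N%:Z = tnth v j.
Proof.
move=> m0; have h0 := half_length_gt0 m0.
move=> /tiled_normal[]; first by rewrite muln_gt0.
move=> u [p [/= ph ->]]; have [r rh rv] := all_words_tuple v.
(* The half of the inflated block that shows the list uncomplemented is the
   first one or the second one, depending on the inflated symbol [u 1]. *)
exists (2 * half_length m - p + (u 1 * half_length m + r))%N.
  by case: (u 1); lia.
move=> j; have jm := ltn_ord j; rewrite /shift.
have -> : (2 * half_length m - p + (u 1 * half_length m + r) + j)%N%:Z + p%:Z =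
    1 * (universal_block m).1%:Z + (u 1 * half_length m + (r + j))%N%:Z.
  by rewrite /=; lia.
rewrite inflateE; last by rewrite /=; case: (u 1); lia.
case: (u 1); last by rewrite mul0n add0n /= rv ifT//; lia.
by rewrite mul1n universal_block_balanced ?addTb ?negbK /= ?rv ?ifT//; lia.
Qed.

(** * Birkhoff sums over balanced blocks *)

Lemma sum_ord_mul (V : nmodType) (M L : nat) (F : nat -> V) :
  \sum_(i < M * L) F i = \sum_(q < M) \sum_(s < L) F (q * L + s)%N.
Proof.
rewrite -(big_mkord xpredT F).
rewrite -(big_mkord xpredT (fun q => \sum_(s < L) F (q * L + s)%N)).
elim: M => [|M IH]; first by rewrite mul0n !big_geq.
rewrite big_nat_recr//= -IH (@big_cat_nat _ _ _ (M * L))//=; last first.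
  by rewrite leq_mul2r leqnSn orbT.
congr (_ + _); rewrite -{1}[(M * L)%N]add0n big_addn mulSn addnK big_mkord.
by apply: eq_bigr => i _; rewrite addnC.
Qed.

Section discrepancy.
Variable R : realType.
Implicit Types (A : set full_shift).

Lemma birkhoff_agree n N A x z : local n A -> agree (n + N) x z ->
  birkhoff R N A x = birkhoff R N A z.
Proof.
move=> lA xz; apply: eq_bigr => i _; have iN := ltn_ord i.
have xzi : agree n (shift (i : nat)%:Z x) (shift (i : nat)%:Z z).
  by apply: agree_shift; apply: agree_le xz; lia.
rewrite !indicE; congr (_%:R); congr nat_of_bool.
by apply/idP/idP; rewrite !inE; [exact: lA|apply: lA; exact: agree_sym].
Qed.

Lemma birkhoff_shift_close N A (p : nat) x :
  `|birkhoff R N A (shift p%:Z x) - birkhoff R N A x| <= p%:R.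
Proof.
elim: p => [|p IH]; first by rewrite shift0 subrr normr0.
rewrite intS -shiftD birkhoff_shift1 addrAC -natr1.
by apply: le_trans (ler_normD _ _) _; rewrite lerD// norm_indicB.
Qed.

Lemma birkhoff_mul M L A x :
  birkhoff R (M * L) A x = \sum_(q < M) birkhoff R L A (shift (q * L)%N%:Z x).
Proof.
rewrite /birkhoff (sum_ord_mul M L (fun i => \1_A (shift i%:Z x) : R)).
apply: eq_bigr => q _; apply: eq_bigr => s _.
by rewrite shiftD PoszD addrC.
Qed.

(** The positions of a block of length [L] whose window of radius [n] sticks out. *)
Lemma boundary_positions n L :
  (\sum_(i < L) ((i < n) || (L <= i + n)) <= 2 * n)%N.
Proof.
have lo l : (\sum_(i < l) (i < n) = minn l n)%N.
  elim: l => [|l IH]; first by rewrite big_ord0 min0n.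
  by rewrite big_ord_recr /= IH; case: (ltnP l n) => /=; lia.
have hi : (\sum_(i < L) (L <= i + n) = \sum_(i < L) (i < n))%N.
  rewrite (reindex_inj rev_ord_inj) /=; apply: eq_bigr => i _.
  by have iL := ltn_ord i; congr nat_of_bool; lia.
apply: (@leq_trans (\sum_(i < L) ((i < n) + (L <= i + n)))).
  by apply: leq_sum => i _; case: (i < n)%N; case: (L <= _)%N.
by rewrite big_split /= hi lo; lia.
Qed.

(** Away from the two ends of a block, the window seen is decided by the symbol that
    the block inflates; the constant sequence serves as a reference point. *)
Lemma birkhoff_block n A P y (q : int) : local n A ->
  `|birkhoff R P.1 A (shift (q * P.1%:Z) (inflate P y))
    - birkhoff R P.1 A (inflate P (fun=> y q))| <= (2 * n)%:R.
Proof.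
move=> lA; rewrite /birkhoff -sumrB; apply: le_trans (ler_norm_sum _ _ _) _.
apply: (@le_trans _ _ (\sum_(i < P.1) (nat_of_bool ((i < n) || (P.1 <= i + n))%N)%:R)); last first.
  by rewrite -natr_sum ler_nat boundary_positions.
apply: ler_sum => i _; have iP := ltn_ord i.
case: (boolP (_ || _)) => [_|]; first by rewrite norm_indicB.
rewrite negb_or -leqNgt -ltnNge => /andP[ni iL].
rewrite [X in `|X|](_ : _ = 0) ?normr0//; apply/eqP; rewrite subr_eq0; apply/eqP.
have xy : agree n (shift (i : nat)%:Z (shift (q * P.1%:Z) (inflate P y)))
    (shift (i : nat)%:Z (inflate P (fun=> y q))).
  move=> t tn; rewrite /shift.
  have -> : t + (i : nat)%:Z + q * P.1%:Z =
    q * P.1%:Z + (absz (t + (i : nat)%:Z))%:Z by lia.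
  have -> : t + (i : nat)%:Z =
    0 * P.1%:Z + (absz (t + (i : nat)%:Z))%:Z by lia.
  by rewrite !inflateE//; lia.
rewrite !indicE; congr (_%:R); congr nat_of_bool.
by apply/idP/idP; rewrite !inE; [exact: lA|apply: lA; exact: agree_sym].
Qed.

(** Each letter of the first half of a universal block is paired off with the letter at the
    same place in the second half. *)
Lemma sum_balanced m M (u : full_shift) (g : bool -> R) : (0 < m)%N ->
  \sum_(q < M * (universal_block m).1) g (inflate (universal_block m) u q%:Z) =
  M%:R * ((half_length m)%:R * (g false + g true)).
Proof.
move=> m0.
rewrite (sum_ord_mul _ _ (fun q => g (inflate (universal_block m) u q%:Z))).
rewrite (eq_bigr (fun=> (half_length m)%:R * (g false + g true))).
  by rewrite sumr_const card_ord [RHS]mulr_natl.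
move=> a _.
under eq_bigr => s _ do rewrite PoszD PoszM inflateE//.
rewrite /= mul2n -addnn big_split_ord /= -big_split /=.
rewrite (eq_bigr (fun=> g false + g true)).
  by rewrite sumr_const card_ord [RHS]mulr_natl.
move=> i _; have := @universal_block_balanced m i (ltn_ord i) => /= ->.
by rewrite ltn_ord; case: (u _); case: (all_words m i) => //=; rewrite addrC.
Qed.

(** The centre of the interval does not depend on [z]. The first error term comes from aligning
    [z] with the blocks of [comp P (universal_block m)], the second one from the ends of
    the blocks of [P]; by balance, the main terms add up to a constant. *)
Lemma tiled_birkhoff n A P m M z : local n A -> (0 < P.1)%N -> (0 < m)%N ->
  tiled (comp P (universal_block m)) z ->
  `|birkhoff R (M * (comp P (universal_block m)).1) A z -
    M%:R * ((half_length m)%:R * (birkhoff R P.1 A (inflate P (fun=> false)) +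
                                  birkhoff R P.1 A (inflate P (fun=> true))))| <=
    ((comp P (universal_block m)).1 + M * (universal_block m).1 * (2 * n))%:R.
Proof.
move=> lA P0 m0 tz; set E := universal_block m; set Q := comp P E.
pose c b := birkhoff R P.1 A (inflate P (fun=> b)).
have E0 : (0 < E.1)%N by rewrite muln_gt0 half_length_gt0.
have Q0 : (0 < Q.1)%N by rewrite muln_gt0 E0.
have [u [p [pQ ->]]] := tiled_normal Q0 tz.
rewrite natrD -(subrKA (birkhoff R (M * Q.1) A (inflate Q u))).
apply: le_trans (ler_normD _ _) (lerD _ _).
  by apply: le_trans (birkhoff_shift_close _ _ _ _) _; rewrite ler_nat ltnW.
have -> : (M * Q.1 = M * E.1 * P.1)%N by rewrite -mulnA.
rewrite /Q inflate_comp// birkhoff_mul -(sum_balanced M u c m0) -sumrB.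
apply: le_trans (ler_norm_sum _ _ _) _.
rewrite natrM -[X in X%:R * _](card_ord (M * E.1)) mulr_natl -sumr_const.
by apply: ler_sum => q _; rewrite PoszM; exact: birkhoff_block.
Qed.

End discrepancy.

(** * The subshift of a tower of blocks *)

Section tower.
Variable m : nat -> nat -> nat.
Hypothesis m_gt0 : forall L k, (0 < m L k)%N.

(** The first inflation makes the next words recurrent at the scale of the current ones, the
    second one raises the complexity; its size [m] may depend on the length reached. *)
Fixpoint tower (k : nat) : block :=
  if k is k'.+1 then
    let P := comp (tower k') pair_block in
    comp P (universal_block (m P.1 k'))
  else (1%N, fun=> false).

Definition half_step (k : nat) : block := comp (tower k) pair_block.

Lemma towerS k :
  tower k.+1 = comp (half_step k) (universal_block (m (half_step k).1 k)).
Proof. by []. Qed.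

Lemma universal_block_gt0 n : (0 < n)%N -> (0 < (universal_block n).1)%N.
Proof. by move=> n0; rewrite muln_gt0 half_length_gt0. Qed.

Lemma comp_gt0 P t : (0 < P.1)%N -> (0 < t.1)%N -> (0 < (comp P t).1)%N.
Proof. by move=> P0 t0; rewrite muln_gt0 t0. Qed.

Lemma tower_gt0 k : (0 < (tower k).1)%N.
Proof.
elim: k => // k IH; rewrite towerS.
by apply: comp_gt0; [exact: comp_gt0|exact: universal_block_gt0].
Qed.

Lemma half_step_gt0 k : (0 < (half_step k).1)%N.
Proof. by apply: comp_gt0 => //; exact: tower_gt0. Qed.

Lemma tower_ge k : (k < (tower k).1)%N.
Proof.
elim: k => // k IH.
have -> : (tower k.+1).1 =
  (2 * half_length (m (half_step k).1 k) * (5 * (tower k).1))%N by [].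
have := half_length_gt0 (m_gt0 (half_step k).1 k); nia.
Qed.

Lemma half_step_ge k : (k < (half_step k).1)%N.
Proof. by have := tower_ge k; rewrite /=; lia. Qed.

Lemma tiled_half_step k z : tiled (tower k.+1) z -> tiled (half_step k) z.
Proof.
rewrite towerS; apply: tiled_comp_tiled; first exact: half_step_gt0.
exact: universal_block_gt0.
Qed.

Lemma tiled_tower k j z : (k <= j)%N -> tiled (tower j) z -> tiled (tower k) z.
Proof.
move=> /subnK <-; elim: (j - k)%N => // i IH /tiled_half_step tz; apply: IH.
by apply: tiled_comp_tiled tz; rewrite ?tower_gt0.
Qed.

(** Asking for windows only makes this set closed by construction. *)
Definition tower_subshift : set full_shift :=
  [set x | forall k N, exists2 z, tiled (tower k) z & agree N x z].

Lemma tower_subshift_shift p x : tower_subshift x -> tower_subshift (shift p x).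
Proof.
move=> Yx k N; have [z tz xz] := Yx k (N + `|p|)%N.
by exists (shift p z); [exact: tiled_shift|exact: agree_shift].
Qed.

Lemma tower_subshift_subshift : subshift tower_subshift.
Proof.
split.
  move=> x clx k N; have [y [Yy xy]] := clx _ (agree_nbhs N x).
  by have [z tz yz] := Yy k N; exists z => //; exact: agree_trans yz.
rewrite left_shiftE; apply/seteqP; split=> [_ [x Yx <-]|x Yx].
  exact: tower_subshift_shift.
exists (shift (-1) x); first exact: tower_subshift_shift.
by rewrite shiftD subrr shift0.
Qed.

Lemma tower_subshift_nonempty : tower_subshift !=set0.
Proof.
have [x xz] := cluster_point (fun j => inflate (tower j) (fun=> false)).
exists x => k N; have [j kj xj] := xz k N.
exists (inflate (tower j) (fun=> false)) => //.
by apply: tiled_tower kj _; exists (fun=> false), 0; rewrite shift0.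
Qed.

(** Linear recurrence at the scales of the tower. The window of [x] straddles two
    blocks of level [k], and every pair of such blocks shows up in each block
    of the half step, which is only five times as long. *)
Lemma tower_recurrence k x x' : tower_subshift x -> tower_subshift x' ->
  exists2 i, (i < 10 * (tower k).1)%N &
    forall j, (j < (tower k).1)%N -> x' (i + j)%N%:Z = x j%:Z.
Proof.
move=> Yx Yx'; set L := (tower k).1; have L0 := tower_gt0 k; rewrite -/L in L0.
have [z tz xz] := Yx k L.
have [z' /tiled_half_step tz' xz'] := Yx' k.+1 (10 * L)%N.
have [y [r [rL zE]]] := tiled_normal L0 tz.
have [y' [p [pL ty' zE']]] := tiled_comp L0 (isT : (0 < pair_block.1)%N) tz'.
have [q [q9 yq yq1]] := tiled_pair_block (y 0) (y 1) ty'.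
rewrite -/L in rL pL.
exists (q * L + r - p)%N; first by nia.
move=> j jL; have pq : (p <= q * L + r)%N by nia.
rewrite xz'; last by rewrite /=; nia.
rewrite xz; last by lia.
rewrite zE zE' /shift.
have -> : (q * L + r - p + j)%N%:Z + p%:Z = (j + r)%N%:Z + q%:Z * L%:Z by lia.
rewrite -/(shift (q%:Z * L%:Z) (inflate (tower k) y') _) -inflate_shift//.
rewrite -PoszD; apply: inflate_pair; first by rewrite -/L; lia.
  by rewrite /shift add0r.
by rewrite /shift -intS.
Qed.

Lemma tower_subshift_minimal : minimal tower_subshift.
Proof.
split; first exact: tower_subshift_nonempty.
move=> Z [cZ sZ] [z Zz] ZY; apply/seteqP; split=> // x Yx.
apply: closed_agree => // N.
(* The window [[- N, N]] has length [2 N + 1], at most that of a level [2 N] block. *)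
have [i _ zx] :=
  tower_recurrence (2 * N) (tower_subshift_shift (- N%:Z) Yx) (ZY _ Zz).
exists (shift (i + N)%N%:Z z); first exact: shift_in.
move=> t tN; have tL := tower_ge (2 * N).
have := zx (absz (t + N%:Z)); rewrite /shift.
have -> : (absz (t + N%:Z))%:Z - N%:Z = t by lia.
have -> : (i + absz (t + N%:Z)%R)%N%:Z = t + (i + N)%N%:Z by lia.
by move=> -> //; lia.
Qed.

(** With a half step of length [L], taking [L] universal blocks makes both errors of
    [tiled_birkhoff] a proportion [O(1 / L)] of the length of the sum. *)
Lemma tower_discrepancy (R : realType) A (e : R) : finitary A -> 0 < e ->
  exists2 N, (0 < N)%N & forall x y, tower_subshift x -> tower_subshift y ->
    birkhoff R N A x <= birkhoff R N A y + e * N%:R.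
Proof.
move=> [n lA] e0.
pose k := Num.truncn ((2 * (1 + 2 * n))%:R / e).
have ke : (2 * (1 + 2 * n))%:R / e < k.+1%:R := truncnS_gt _.
set P := half_step k; set E := universal_block (m P.1 k).
have P0 : (0 < P.1)%N := half_step_gt0 k.
have E0 : (0 < E.1)%N by exact: universal_block_gt0.
have kP : k.+1%:R <= P.1%:R :> R by rewrite ler_nat half_step_ge.
have N0 : (0 < P.1 * (comp P E).1)%N by rewrite muln_gt0 P0; exact: comp_gt0.
exists (P.1 * (comp P E).1)%N => // x y Yx Yy.
set N := (P.1 * _)%N.
have [u tu xu] := Yx k.+1 (n + N)%N.
have [v tv yv] := Yy k.+1 (n + N)%N.
rewrite (birkhoff_agree R lA xu) (birkhoff_agree R lA yv).
have [D near_D] : exists D : R, forall w, tiled (tower k.+1) w ->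
    `|birkhoff R N A w - D| <= ((comp P E).1 + P.1 * E.1 * (2 * n))%:R.
  by eexists => w tw; exact: (tiled_birkhoff _ _ lA P0 (m_gt0 _ _) tw).
have := near_D _ tu; have := near_D _ tv.
rewrite !ler_norml => /andP[v1 _] /andP[_ u2].
suff : 2 * ((comp P E).1 + P.1 * E.1 * (2 * n))%:R <= e * N%:R. by lra.
have -> : ((comp P E).1 + P.1 * E.1 * (2 * n) =
  E.1 * P.1 * (1 + 2 * n))%N by rewrite /=; lia.
have -> : N = (E.1 * P.1 * P.1)%N by rewrite /N /=; lia.
move: E0 P0 kP ke; move: E.1 P.1 => a b a0 b0 kb ke.
rewrite !natrM mulrCA [leRHS]mulrCA ler_pM2l; last by rewrite mulr_gt0 ?ltr0n.
rewrite -natrM; move: ke; rewrite ltr_pdivrMr// mulrC => ke.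
by apply: le_trans (ltW ke) _; rewrite ler_pM2l.
Qed.

(** A single point shows all inflated words of length [m] in one block of level [k + 1], and
    they are distinct because the first letter of a block determines its symbol. *)
Lemma tower_complexity k :
  (2 ^ m (half_step k).1 k <=
   complexity tower_subshift (m (half_step k).1 k * (half_step k).1))%N.
Proof.
set P := half_step k; set L := P.1; set M := m L k.
have P0 : (0 < P.1)%N := half_step_gt0 k; have M0 : (0 < M)%N := m_gt0 _ _.
pose seq_point (v : M.-tuple bool) : full_shift := fun t => nth false v `|t|.
pose W (v : M.-tuple bool) :=
  [tuple inflate P (seq_point v) (i : nat)%:Z | i < M * L].
have W_inj : injective W.
  move=> v v' vv'; apply/eq_from_tnth => a; have aM := ltn_ord a.
  have aL : (a * L < M * L)%N by rewrite ltn_pmul2r.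
  have := congr1 (fun w => tnth w (Ordinal aL)) vv'.
  rewrite !tnth_mktuple /=.
  have -> : (a * L)%N%:Z = (a : nat)%:Z * P.1%:Z + 0%N%:Z by rewrite -/L; lia.
  by rewrite !inflateE// => /addIb; rewrite /seq_point /= -!tnth_nth.
have <- : #|W @: [set: M.-tuple bool]%SET| = (2 ^ M)%N.
  by rewrite card_imset// cardsT card_tuple card_bool.
apply: subset_leq_card; apply/fintype.subsetP => w /imsetP[v _ ->].
rewrite inE; apply/asboolP.
have [x Yx] := tower_subshift_nonempty.
have [z tz xz] := Yx k.+1 (4 * half_length M * L)%N.
have [y [p [pL ty zE]]] := tiled_comp P0 (universal_block_gt0 M0) tz.
have [q /andP[q0 qM] yq] := tiled_universal_block v M0 ty.
exists (shift (q * L - p)%N%:Z x); split; first exact: tower_subshift_shift.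
move=> j; rewrite tnth_mktuple; have jM := ltn_ord j.
have [a [s [sL jE]]] := divz_decomposition (j : nat)%:Z P0.
rewrite /shift xz; last by rewrite -/L in pL; nia.
rewrite zE /shift.
have -> : (j : nat)%:Z + (q * L - p)%N%:Z + p%:Z = (a + q%:Z) * P.1%:Z + s%:Z.
  by rewrite -/L in pL jE *; nia.
have a0 : 0 <= a by nia.
have aM : (absz a < M)%N by rewrite -/L in jE; nia.
rewrite jE !inflateE//; congr (_ (+) _); rewrite /seq_point.
have := yq (Ordinal aM); rewrite (tnth_nth false) /= => <-.
by congr y; lia.
Qed.

End tower.

(** * Limits and subexponential growth *)

Lemma limn_esup_lt_near (R : realType) (u : nat -> \bar R) (e : \bar R) :
  (limn_esup u < e)%E -> exists N, forall n, (N <= n)%N -> (u n < e)%E.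
Proof.
rewrite /limn_esup /limf_esup => /ereal_inf_lt[_ [V [N _ NV] <-] Ve].
exists N => n Nn; apply: le_lt_trans Ve; apply: ereal_sup_ubound.
by exists n => //; exact: NV.
Qed.

Lemma limn_esup_eqy (R : realType) (u : nat -> \bar R) :
  (forall k : nat, exists2 n, (k <= n)%N & (k%:R%:E <= u n)%E) ->
  limn_esup u = +oo%E.
Proof.
move=> uk; apply/eqP; rewrite -leye_eq.
apply: le_ereal_inf_tmp => _ [V [N _ NV] <-].
rewrite leye_eq; apply/eqP/eq_infty => r.
have [n kn un] := uk (maxn N (Num.truncn r).+1).
apply: le_trans (ereal_sup_ubound _); last first.
  by exists n; [apply: NV => /=; lia|reflexivity].
apply: le_trans un; rewrite lee_fin; apply: le_trans (ltW (truncnS_gt r)) _.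
by rewrite ler_nat leq_maxr.
Qed.

Lemma le_limn_einf (R : realType) (u : nat -> \bar R) (l : \bar R) :
  (forall n, l <= u n)%E -> (l <= limn_einf u)%E.
Proof.
move=> lu; rewrite /limn_einf leeNr.
apply: le_trans (ereal_inf_lbound _) _.
  by exists setT; [exact: filterT|reflexivity].
by apply: ge_ereal_sup => _ [n _ <-]; rewrite leeN2.
Qed.

Lemma subexponential_le_exp2 (R : realType) (a : nat -> nat) :
  (forall n, (0 < n)%N -> (0 < a n)%N) ->
  limn_esup (fun n => (n%:R^-1 * ln (a n)%:R : R)%:E) = 0%E ->
  forall L k, (0 < L)%N -> exists2 m, (0 < m)%N & (k * a (m * L) <= 2 ^ m)%N.
Proof.
move=> a_gt0 a_subexp L k L0.
have L0r : 0 < L%:R :> R by rewrite ltr0n.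
have e0 : 0 < ln 2 / (2 * L%:R) :> R by rewrite divr_gt0 ?mulr_gt0// ln_gt0// ltr1n.
have : (0 < (ln 2 / (2 * L%:R) : R)%:E)%E by rewrite lte_fin.
rewrite -a_subexp => /limn_esup_lt_near[N aN].
(* Half of the exponent pays for the growth of [a], the other half for [k]. *)
pose h := (k + N).+1; exists (2 * h)%N => //.
have n0 : (0 < 2 * h * L)%N by rewrite !muln_gt0.
have aE : (a (2 * h * L) <= 2 ^ h)%N.
  rewrite -(ler_nat R) natrX -ler_ln ?posrE ?exprn_gt0 ?ltr0n ?a_gt0//.
  rewrite lnXn//.
  have : (N <= 2 * h * L)%N by rewrite /h; nia.
  move=> /aN; rewrite lte_fin => /ltW; rewrite ler_pdivrMl ?ltr0n// => aL.
  apply: le_trans aL _; rewrite [leLHS](_ : _ = ln 2 *+ h)//.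
  by rewrite -mulr_natl natrM; field; rewrite lt0r_neq0.
apply: leq_trans (leq_mul (ltnW (ltn_expl k (isT : 1 < 2)%N)) aE) _.
by rewrite -expnD leq_exp2l//; rewrite /h; lia.
Qed.


(** * The theorem *)

Section main.
Variables (R : realType) (m : nat -> nat -> nat).
Hypothesis m_gt0 : forall L k, (0 < m L k)%N.
Let Y := tower_subshift m.

(** By recurrence, [w] occurs in every window of length ten times its own. *)
Lemma tower_cylinder_measure (mu : probability borel_full_shift R) k
    (w : ((tower m k).1).-tuple bool) :
  invariant_on Y mu -> w \in language Y (tower m k).1 ->
  (10^-1%:E <= mu (cylinder Y w) * ((tower m k).1%:R)%:E)%E.
Proof.
move=> imu; rewrite inE => /asboolP[x [Yx xw]]; set L := (tower m k).1.
have mY := closed_measurable (tower_subshift_subshift m).1.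
pose A : set full_shift := [set x | forall j : 'I_L, x (j : nat)%:Z = tnth w j].
have fA : finitary A.
  exists L => y z yz Ay j; have jL := ltn_ord j.
  by rewrite -yz ?Ay//=; lia.
have mC : measurable (cylinder Y w : set borel_full_shift).
  by apply: measurableI => //; exact: (finitary_measurable fA).
have cfin : mu (cylinder Y w) \is a fin_num by exact: fin_num_measure.
have : (1%:E <= (10 * L)%:R%:E * mu (cylinder Y w))%E.
  apply: (le_birkhoff_measure imu) => // y Yy.
  have [i iL yx] := tower_recurrence m_gt0 k Yx Yy.
  rewrite /birkhoff (bigD1 (Ordinal iL))//= indicE mem_set ?lerDl ?sumr_ge0//.
  split; first exact: tower_subshift_shift.
  by move=> j; rewrite -xw -yx// /shift addrC.
rewrite -(fineK cfin) -!EFinM !lee_fin natrM => h.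
by rewrite -(ler_pM2l (_ : 0 < 10)) ?ltr0n// mulfV ?pnatr_eq0//; move: h; lra.
Qed.

End main.

Theorem theorem1p1 (R : realType) (a : nat -> nat)
  (a_gt0 : forall n, (0 < n)%N -> (0 < a n)%N)
  (a_subexp : limn_esup (fun n => (n%:R^-1 * ln (a n)%:R : R)%:E) = 0%E) :
  exists Y : set full_shift,
    [/\ subshift Y,
        minimal Y,
        uniquely_ergodic R Y,
        limn_esup (fun n => ((complexity Y n)%:R / (a n)%:R : R)%:E) = +oo%E &
        forall mu : probability borel_full_shift R, invariant_on Y mu ->
          exists nk : nat -> nat,
            [/\ forall k, (0 < nk k)%N,
                nk k @[k --> \oo] --> \oo &
                (0 < limn_einf (fun k =>
                  \big[mine/+oo]_(w in language Y (nk k))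
                    (mu (cylinder Y w) * ((nk k)%:R)%:E)))%E]].
Proof.
have exp2 := subexponential_le_exp2 a_gt0 a_subexp.
have [m mP] : exists m : nat -> nat -> nat, forall L k,
    (0 < m L k)%N /\ ((0 < L)%N -> (k * a (m L k * L) <= 2 ^ m L k)%N).
  suff /choice[f fP] : forall Lk : nat * nat, exists n,
      (0 < n)%N /\ ((0 < Lk.1)%N -> (Lk.2 * a (n * Lk.1) <= 2 ^ n)%N).
    by exists (fun L k => f (L, k)) => L k; exact: fP (L, k).
  move=> [L k]; have [->|L0] := posnP L; first by exists 1%N.
  by have [n n0 nk] := exp2 L k L0; exists n.
have m_gt0 L k : (0 < m L k)%N by case: (mP L k).
have sY := tower_subshift_subshift m; have Y0 := tower_subshift_nonempty m_gt0.
exists (tower_subshift m); split => //.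
- exact: tower_subshift_minimal.
- have [mu imu] := invariant_probability R sY Y0.
  apply: (discrepancy_uniquely_ergodic sY.1 Y0 _ imu) => A fA e e0.
  exact: tower_discrepancy.
- apply: limn_esup_eqy => k; set L := (half_step m k).1.
  have kL : (k < L)%N := half_step_ge m_gt0 k.
  have n0 : (0 < m L k * L)%N by rewrite muln_gt0 m_gt0; lia.
  exists (m L k * L)%N; first by have := m_gt0 L k; nia.
  rewrite lee_fin ler_pdivlMr ?ltr0n ?a_gt0// -natrM ler_nat.
  apply: leq_trans (tower_complexity m_gt0 k).
  by apply: (mP L k).2; lia.
move=> mu imu; exists (fun k => (tower m k).1); split.
- exact: tower_gt0.
- move=> V [n _ nV]; exists n => // k /= nk; apply: nV => /=.
  exact: leq_trans nk (ltnW (tower_ge m_gt0 k)).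
apply: (@lt_le_trans _ _ 10^-1%:E); first by rewrite lte_fin.
apply: le_limn_einf => k.
apply: (big_ind (fun x => 10^-1%:E <= x)%E) => //.
- by rewrite leey.
- by move=> x y xl yl; rewrite le_min xl.
- by move=> w; exact: tower_cylinder_measure.
Qed.
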